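(* Let $m,n\ge 1$ and $t>2$ be integers, and let $G_{m,n}$ be the $m\times n$ grid graph. Then \[\gamma_{t,2}(G_{m,n}) \ge \frac{mn}{2(t-1)^2}.\]
   Context: The $m\times n$ grid graph $G_{m,n}$ has vertex set $\{(i,j)\in\mathbb{Z}^2: 0\le i<m,\ 0\le j<n\}$, with two vertices adjacent iff they differ by 1 in exactly one coordinate. For a graph $G=(V,E)$ and positive integers $t,r$, a tower vertex $T\in V$ supplies to a vertex $v\in V$ the signal $sig(T,v)=\max(t-dist(T,v),0)$, where $dist$ is the graph (shortest-path) distance. A $(t,r)$ broadcast on $G$ is a set $\mathbb{T}\subseteq V$ such that for every $v\in V$, $\sum_{T\in\mathbb{T}} sig(T,v)\ge r$. The $(t,r)$ broadcast domination number $\gamma_{t,r}(G)$ is the minimum cardinality of a $(t,r)$ broadcast on $G$. *)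

(* Defs.v *)
From mathcomp Require Import all_boot.

Set Implicit Arguments.
Unset Strict Implicit.
Unset Printing Implicit Defensive.

(* A graph on the finite vertex type V is given by its adjacency relation.    *)
Section Broadcast.

Variables (V : finType) (e : rel V).
Implicit Types (x y v : V) (S : {set V}) (t r k : nat).

Definition has_walk x y k : bool :=
  [exists p : k.-tuple V, path e x p && (last x p == y)].

(* A shortest walk has fewer than #|V| edges, so the search range suffices.   *)
(* The value is #|V| when x and y are not connected; sig then ignores it.     *)
Definition dist x y : nat := find (has_walk x y) (iota 0 #|V|).

(* Truncated subtraction is the maximum with 0; a vertex at infinite distance *)
(* from the tower x receives no signal.                                       *)
Definition sig t x v : nat := if connect e x v then t - dist x v else 0.

Definition broadcast t r S : bool :=
  [forall v, r <= \sum_(x in S) sig t x v].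

(* Broadcasts are upward closed, so [set: V] is a broadcast as soon as there  *)
(* is one; otherwise the minimum does not exist and the value is #|V|.        *)
Definition broadcast_number t r : nat :=
  #|[arg min_(S < [set: V] | broadcast t r S) #|S|]|.

Lemma has_walkP x y k :
  reflect (exists p, [/\ path e x p, last x p = y & size p = k])
          (has_walk x y k).
Proof.
apply: (iffP existsP) => [[p /andP[ep /eqP lp]]|[p [ep lp sp]]].
  by exists p; rewrite size_tuple.
have spk : size p == k by apply/eqP.
by exists (Tuple spk); rewrite /= ep lp eqxx.
Qed.

Lemma dist_has_walk x y : connect e x y -> has_walk x y (dist x y).
Proof.
move=> /connectP[p0 /shortenP[p ep up _] ->].
have szp : size p < #|V|.
  by have := max_card [in x :: p]; rewrite (card_uniqP up).
have hw : has (has_walk x (last x p)) (iota 0 #|V|).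
  apply/hasP; exists (size p); first by rewrite mem_iota.
  by apply/has_walkP; exists p.
have := nth_find 0 hw; rewrite nth_iota //.
by move: hw; rewrite has_find size_iota.
Qed.

Lemma dist_min x p : path e x p -> dist x (last x p) <= size p.
Proof.
move=> ep; rewrite leqNgt; apply/negP => lt_pd.
have lt_pV : size p < #|V|.
  by apply: leq_trans lt_pd _; rewrite -[X in _ <= X](size_iota 0) find_size.
have := before_find 0 lt_pd; rewrite nth_iota // add0n => /negbT/negP; apply.
by apply/has_walkP; exists p.
Qed.

Lemma broadcast_sub t r S S' :
  S \subset S' -> broadcast t r S -> broadcast t r S'.
Proof.
move=> sSS' /forallP bS; apply/forallP => v; apply: leq_trans (bS v) _.
rewrite [X in _ <= X](big_setID S) /= (setIidPr sSS').
exact: leq_addr.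
Qed.

Lemma broadcast_numberP t r :
  (exists S, broadcast t r S) ->
  (exists2 S, broadcast t r S & #|S| = broadcast_number t r) /\
  (forall S, broadcast t r S -> broadcast_number t r <= #|S|).
Proof.
case=> S0 /(broadcast_sub (subsetT S0)) bT; rewrite /broadcast_number.
by case: arg_minnP => // S bS minS; split=> //; exists S.
Qed.

Lemma broadcastT t r : r <= t -> broadcast t r [set: V].
Proof.
move=> le_rt; apply/forallP => v.
have d0 : dist v v = 0 by apply/eqP; rewrite -leqn0 (@dist_min v [::]).
rewrite (bigD1 v) //= /sig connect0 d0 subn0.
exact: leq_trans le_rt (leq_addr _ _).
Qed.

End Broadcast.

Definition consecutive (a b : nat) : bool := (a.+1 == b) || (b.+1 == a).

Definition grid_adj (m n : nat) : rel ('I_m * 'I_n) := fun u v =>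
  consecutive u.1 v.1 && (u.2 == v.2) || (u.1 == v.1) && consecutive u.2 v.2.

Lemma grid_adj_sym m n : symmetric (@grid_adj m n).
Proof.
have cC a b : consecutive a b = consecutive b a by rewrite /consecutive orbC.
by move=> u v; rewrite /grid_adj !(cC v.1, cC v.2) ![v.1 == _]eq_sym ![v.2 == _]eq_sym.
Qed.

Lemma grid_adj_irr m n : irreflexive (@grid_adj m n).
Proof.
have ci a : consecutive a a = false by rewrite /consecutive gtn_eqF.
by move=> u; rewrite /grid_adj !ci andbF.
Qed.

(* Main.v *)
(** Write r = t - 1. Translates of the grid tile Z^2, and copying the towers along
    turns a broadcast into a doubly periodic set of towers in which every vertex has
    a tower at distance at most r - 1 or two towers at distance at most r.  It is
    enough to bound the density of such a set from below by 1 / (2 r^2).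

    The L1-ball of radius r around a tower, as a region of the plane, has area 2 r^2,
    so the claim is that these balls cover the plane at least once on average.  They
    may leave gaps.  The load of a unit square is twice the area of the balls inside
    it: a tower at distance d from the nearest corner contributes min(2, r - d).  A
    square of load 0 or 1 has two towers at distance exactly r from some corner, in
    the quadrant beyond that corner, and this forces overlaps in squares nearby; it
    claims its missing load there.  The claims (up to symmetry, on a side neighbour,
    a diagonal neighbour, or the square two steps away) are chosen so that a square
    receiving c > 0 of them has load at least 2 + c.  As the number of claims sent
    and received agree over a period, the average load is at least 2.  *)
From Stdlib Require Import ZArith Lia.
Require Import Defs.
From mathcomp Require Import all_boot all_order all_algebra.
From mathcomp Require Import boolp zify.
Set Implicit Arguments.
Unset Strict Implicit.
Unset Printing Implicit Defensive.

Definition config := Z -> Z -> bool.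
Implicit Type C : config.

Arguments Z.add : simpl never.
Arguments Z.sub : simpl never.
Arguments Z.opp : simpl never.

(** * Load and claims *)

Section Discharging.
Local Open Scope Z_scope.

(** The reflection [1 - x] exchanges 0 and 1, so [view] and [swap] generate the eight symmetries of
    [0, 1]^2, and each kind of claim is described at one corner or side only. *)
Definition mirror (s : bool) (x : Z) : Z := if s then 1 - x else x.
Definition view (C : config) (s1 s2 : bool) : config :=
  fun x y => C (mirror s1 x) (mirror s2 y).
Definition swap (C : config) : config := fun x y => C y x.
Definition shift (C : config) (i j : Z) : config := fun x y => C (x + i) (y + j).

Lemma mirrorK s : involutive (mirror s).
Proof. by case: s => x /=; lia. Qed.

Lemma view_view C s1 s2 s1' s2' :
  view (view C s1 s2) s1' s2' = view C (s1 (+) s1') (s2 (+) s2').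
Proof.
apply/funext => x; apply/funext => y; rewrite /view.
by case: s1 s1' s2 s2' => [] [] [] [] /=; congr C; lia.
Qed.

Lemma view_id C : view C false false = C.
Proof. by []. Qed.

Lemma swapK : involutive swap.
Proof. by []. Qed.

Definition covering (r : Z) (C : config) : Prop := forall x y,
  (exists p q, C p q /\ Z.abs (x - p) + Z.abs (y - q) <= r - 1) \/
  (exists p q p' q', [/\ C p q, C p' q', p <> p' \/ q <> q',
     Z.abs (x - p) + Z.abs (y - q) <= r & Z.abs (x - p') + Z.abs (y - q') <= r]).

Lemma covering_view r C s1 s2 : covering r C -> covering r (view C s1 s2).
Proof.
move=> cC x y.
case: (cC (mirror s1 x) (mirror s2 y)) => [[p [q [Cpq d]]]|[p [q [p' [q' [Cp Cp' ne d d']]]]]].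
  left; exists (mirror s1 p), (mirror s2 q); rewrite /view !mirrorK; split=> //.
  by move: d; case: s1 s2 => [] [] /=; lia.
right; exists (mirror s1 p), (mirror s2 q), (mirror s1 p'), (mirror s2 q').
by rewrite /view !mirrorK; split=> //; move: ne d d'; case: s1 s2 => [] [] /=; lia.
Qed.

Lemma covering_swap r C : covering r C -> covering r (swap C).
Proof.
move=> cC x y.
case: (cC y x) => [[p [q [Cpq d]]]|[p [q [p' [q' [Cp Cp' ne d d']]]]]].
  by left; exists q, p; split=> //; lia.
by right; exists q, p, q', p'; split=> //; lia.
Qed.

Lemma covering_shift r C i j : covering r C -> covering r (shift C i j).
Proof.
move=> cC x y; rewrite /shift.
case: (cC (x + i) (y + j)) => [[p [q [Cpq d]]]|[p [q [p' [q' [Cp Cp' ne d d']]]]]].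
  by left; exists (p - i), (q - j); rewrite !Z.sub_add; split=> //; lia.
right; exists (p - i), (q - j), (p' - i), (q' - j).
by rewrite !Z.sub_add; split=> //; lia.
Qed.

Variable r : nat.
Local Notation R := (Z.of_nat r).

(** The part of the load of the square [0, 1]^2 due to towers nearest to its corner (0, 0). *)
Definition quad (C : config) : nat :=
  (\sum_(a < r) \sum_(b < r)
     C (- Z.of_nat a) (- Z.of_nat b) * minn 2 (r - (a + b)))%N.

Definition load (C : config) : nat :=
  (\sum_(s1 : bool) \sum_(s2 : bool) quad (view C s1 s2))%N.

Lemma loadE C : load C = (quad (view C true true) + quad (view C true false)
  + quad (view C false true) + quad C)%N.
Proof. by rewrite /load !big_bool /= addnA. Qed.

Lemma quad_swap C : quad (swap C) = quad C.
Proof.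
rewrite /quad exchange_big; apply: eq_bigr => a _; apply: eq_bigr => b _.
by rewrite (addnC (nat_of_ord b)).
Qed.

Lemma load_swap C : load (swap C) = load C.
Proof.
have qs s1 s2 : quad (view (swap C) s1 s2) = quad (view C s2 s1).
  exact: (quad_swap (view C s2 s1)).
by rewrite !loadE !qs quad_swap; lia.
Qed.

Lemma load_view C s1 s2 : load (view C s1 s2) = load C.
Proof.
rewrite !loadE !view_view !addbF !addbT.
by case: s1 s2 => [] [] /=; rewrite ?view_id; lia.
Qed.

Lemma opp_to_nat x : x <= 0 -> - Z.of_nat (Z.to_nat (- x)) = x.
Proof. lia. Qed.

Lemma depth_to_nat x y : x <= 0 -> y <= 0 ->
  (r - (Z.to_nat (- x) + Z.to_nat (- y)))%N = Z.to_nat (R + x + y).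
Proof. lia. Qed.

Lemma quad_tower C x y : C x y -> x <= 0 -> y <= 0 -> x + y >= 1 - R ->
  (minn 2 (Z.to_nat (R + x + y)) <= quad C)%N.
Proof.
move=> Cxy x0 y0 xy.
have ha : (Z.to_nat (- x) < r)%N by lia.
have hb : (Z.to_nat (- y) < r)%N by lia.
rewrite /quad (bigD1 (Ordinal ha)) //= (bigD1 (Ordinal hb)) //=.
by rewrite !opp_to_nat // Cxy mul1n depth_to_nat // -addnA leq_addr.
Qed.

Lemma quad_tower2 C x y x' y' : C x y -> C x' y' -> x <> x' \/ y <> y' ->
  x <= 0 -> y <= 0 -> x' <= 0 -> y' <= 0 -> x + y >= 1 - R -> x' + y' >= 1 - R ->
  (minn 2 (Z.to_nat (R + x + y)) + minn 2 (Z.to_nat (R + x' + y')) <= quad C)%N.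
Proof.
move=> Cxy Cxy' ne x0 y0 x0' y0' xy xy'.
have ha : (Z.to_nat (- x) < r)%N by lia.
have hb : (Z.to_nat (- y) < r)%N by lia.
have ha' : (Z.to_nat (- x') < r)%N by lia.
have hb' : (Z.to_nat (- y') < r)%N by lia.
rewrite /quad pair_big /= (bigD1 (Ordinal ha, Ordinal hb)) //=.
rewrite (bigD1 (Ordinal ha', Ordinal hb')) /=; last first.
  by rewrite xpair_eqE -!val_eqE /=; lia.
by rewrite !opp_to_nat // Cxy Cxy' !mul1n !depth_to_nat // addnA leq_addr.
Qed.

Lemma quad_gt0 C : (0 < quad C)%N ->
  exists x y, [/\ C x y, x <= 0, y <= 0 & x + y >= 1 - R].
Proof.
rewrite lt0n => /eqP nz; apply: contrapT => no; apply: nz.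
rewrite /quad big1 // => a _; rewrite big1 // => b _.
case Cab: (C _ _) => //; case: (ltnP (a + b) r) => ab; last by lia.
by case: no; exists (- Z.of_nat a), (- Z.of_nat b); split=> //; lia.
Qed.

(** Distance from the integer [x] to the nearer of 0 and 1. *)
Definition gap (x : Z) : Z := Z.max (- x) (x - 1).

Lemma load_gt0 C : (0 < load C)%N ->
  exists x y, C x y /\ gap x + gap y <= R - 1.
Proof.
have H s1 s2 : (0 < quad (view C s1 s2))%N ->
    exists x y, C x y /\ gap x + gap y <= R - 1.
  move=> /quad_gt0[x [y [Cxy x0 y0 xy]]].
  exists (mirror s1 x), (mirror s2 y); split=> //.
  by rewrite /gap /mirror; case: s1 s2 Cxy => [] [] /=; lia.
rewrite loadE !addn_gt0 => /orP[/orP[/orP[]|]|]; try exact: H.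
exact: (H false false).
Qed.

Lemma quad_le_load C s1 s2 : (quad (view C s1 s2) <= load C)%N.
Proof. by rewrite loadE; case: s1 s2 => [] []; rewrite ?view_id; lia. Qed.

Lemma quads_le_load C s1 s2 s1' s2' : (s1, s2) <> (s1', s2') ->
  (quad (view C s1 s2) + quad (view C s1' s2') <= load C)%N.
Proof.
by rewrite loadE; case: s1 s2 s1' s2' => [] [] [] [] //; rewrite ?view_id; lia.
Qed.

Lemma quadrantP x y : exists s1 s2 x' y',
  [/\ x = mirror s1 x', y = mirror s2 y', x' <= 0, y' <= 0 & gap x + gap y = - x' - y'].
Proof.
exists (0 <? x), (0 <? y), (mirror (0 <? x) x), (mirror (0 <? y) y).
by rewrite !mirrorK /mirror /gap; split=> //; case: (Z.ltb_spec 0 x); case: (Z.ltb_spec 0 y); lia.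
Qed.

Lemma load_tower C x y : C x y -> gap x + gap y <= R - 1 ->
  (minn 2 (Z.to_nat (R - gap x - gap y)) <= load C)%N.
Proof.
case: (quadrantP x y) => s1 [s2 [x' [y' [-> -> x0 y0 e]]]] Cxy g.
have := @quad_tower (view C s1 s2) x' y' Cxy x0 y0.
have := quad_le_load C s1 s2; lia.
Qed.

Lemma load_tower2 C x y x' y' : C x y -> C x' y' -> x <> x' \/ y <> y' ->
  gap x + gap y <= R - 1 -> gap x' + gap y' <= R - 1 -> (2 <= load C)%N.
Proof.
case: (quadrantP x y) => s1 [s2 [x1 [y1 [-> -> x0 y0 e]]]].
case: (quadrantP x' y') => s1' [s2' [x1' [y1' [-> -> x0' y0' e']]]].
move=> Cxy Cxy' ne g g'.
have [es|/eqP ns] := eqVneq (s1, s2) (s1', s2').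
  case: es => ? ?; subst s1' s2'.
  have ne' : x1 <> x1' \/ y1 <> y1'.
    by case: ne => ne; [left|right] => E; apply: ne; rewrite E.
  have := @quad_tower2 (view C s1 s2) x1 y1 x1' y1' Cxy Cxy' ne' x0 y0 x0' y0'.
  have := quad_le_load C s1 s2; lia.
have := @quad_tower (view C s1 s2) x1 y1 Cxy x0 y0.
have := @quad_tower (view C s1' s2') x1' y1' Cxy' x0' y0'.
have := quads_le_load C ns; lia.
Qed.

Lemma load0_gap C : load C = 0%N -> forall x y, C x y -> R <= gap x + gap y.
Proof.
move=> l0 x y Cxy; case: (Z_lt_le_dec (gap x + gap y) R) => // g.
by have := load_tower Cxy; rewrite l0; lia.
Qed.

Lemma load_le1_gap C : (load C <= 1)%N ->
  forall x y, C x y -> R - 1 <= gap x + gap y.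
Proof.
move=> l1 x y Cxy; case: (Z_lt_le_dec (gap x + gap y) (R - 1)) => // g.
by have := load_tower Cxy; lia.
Qed.

Lemma load_le1_uniq C : (load C <= 1)%N -> forall x y x' y', C x y -> C x' y' ->
  gap x + gap y <= R - 1 -> gap x' + gap y' <= R - 1 -> x = x' /\ y = y'.
Proof.
move=> l1 x y x' y' Cxy Cxy' g g'; apply: contrapT => ne.
have ne' : x <> x' \/ y <> y'.
  case: (Z.eq_dec x x') => [ex|]; last by left.
  by right=> ey; apply: ne.
by have := load_tower2 Cxy Cxy' ne' g g'; lia.
Qed.

Ltac split_lia := repeat match goal with
  | |- and3 _ _ _ => split | |- and4 _ _ _ _ => split | |- _ /\ _ => split end; lia.

(** A claim of the square [0, 1]^2 on the square below it: the tower nearest to (0, 0)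
    overlaps there with the second tower reaching (1, 0). *)
Definition side_claim C : Prop :=
  [/\ (load C <= 1)%N,
      exists x y, [/\ C x y, x <= 0, y <= -1 & x + y = 1 - R] &
      exists x y, [/\ C x y, 1 <= x, y <= -1 & x - 1 - y = R]].

(** A claim on the square [2, 3] x [0, 1], which lies in the balls of both towers. *)
Definition far_claim C : Prop :=
  [/\ (load C <= 1)%N, C (1 + R) 0 & C (1 + R) 1].

(** A claim on the square [-1, 0]^2, through the two towers reaching (0, 0).  If the
    square [0, 1]^2 has load 1, it is made only when none of the side and far claims
    around the corner (0, 0) is available: otherwise a square could be charged twice
    for the same overlap. *)
Definition diag_claim C : Prop :=
  [/\ (load C <= 1)%N,
      exists x y x' y',
        [/\ C x y, C x' y', x <> x' \/ y <> y',
            [/\ x <= -1, y <= -1 & x + y = - R] &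
            [/\ x' <= 0, y' <= 0 & x' + y' = - R]] &
      load C = 0%N \/
      [/\ exists x y, [/\ C x y, 1 <= x, 1 <= y & x + y = R + 1],
          ~ side_claim (view C true true),
          ~ side_claim (swap (view C true true)),
          ~ far_claim (view C true true) &
          ~ far_claim (swap (view C true true))]].

(** * Claims available to squares of load 0 or 1 *)

Hypothesis r_gt1 : (1 < r)%N.

(** With load 0 every tower is at distance at least R from all four corners. Hence two towers at
    distance exactly R reach (0, 0), and outside the quadrant beyond (0, 0) they would be nearer to
    another corner. *)
Lemma corner_towers_load0 C : covering R C -> load C = 0%N ->
  exists x y x' y', [/\ C x y, C x' y', x <> x' \/ y <> y',
    [/\ x <= 0, y <= 0 & x + y = - R] & [/\ x' <= 0, y' <= 0 & x' + y' = - R]].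
Proof.
move=> cC l0; have g := load0_gap l0.
case: (cC 0 0) => [[p [q [Cpq d]]]|[p [q [p' [q' [Cp Cp' ne d d']]]]]].
  by exfalso; have := g _ _ Cpq; rewrite /gap; lia.
exists p, q, p', q'; split=> //.
  by have := g _ _ Cp; rewrite /gap => ?; split_lia.
by have := g _ _ Cp'; rewrite /gap => ?; split_lia.
Qed.

(** A point of the quadrant at distance R either has both coordinates negative or is one of the two
    tips on the axes. *)
Lemma diag_claim_load0 C : covering R C -> load C = 0%N ->
  diag_claim C \/ (C (- R) 0 /\ C 0 (- R)).
Proof.
move=> cC l0; have l1 : (load C <= 1)%N by rewrite l0.
have [x [y [x' [y' [Cxy Cxy' ne [x0 y0 xy] [x0' y0' xy']]]]]] :=
  corner_towers_load0 cC l0.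
case: (pselect (x <= -1 /\ y <= -1)) => [[xn yn]|nt].
  left; split=> //; last by left.
  by exists x, y, x', y'.
case: (pselect (x' <= -1 /\ y' <= -1)) => [[xn yn]|nt'].
  left; split=> //; last by left.
  by exists x', y', x, y; split=> //; split_lia.
right; case: (Z.eq_dec x 0) => xe.
  have [ye xe' ye'] : [/\ y = - R, x' = - R & y' = 0] by split; lia.
  by split; [rewrite -xe' -ye'|rewrite -xe -ye].
have [xe2 ye xe' ye'] : [/\ x = - R, y = 0, x' = 0 & y' = - R] by split; lia.
by split; [rewrite -xe2 -ye|rewrite -xe' -ye'].
Qed.

Lemma gap_corner11 u v : Z.abs (1 - u) + Z.abs (1 - v) <= R ->
  R <= gap u + gap v -> [/\ 1 <= u, 1 <= v & u + v = R + 2].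
Proof. by rewrite /gap => *; split_lia. Qed.

(** The only contributing tower (a, b) is at distance R from (1, 0) and (0, 1) and R + 1 from (1,
    1). Further towers must therefore reach these corners, and their positions decide which claim is
    available. *)
Lemma claim_load1 C : covering R C -> load C = 1%N ->
    (exists x y, [/\ C x y, x <= 0, y <= 0 & x + y = 1 - R]) ->
  [\/ side_claim C, side_claim (swap C), far_claim C \/ far_claim (swap C)
    | diag_claim (view C true true)].
Proof.
move=> cC l1 [a [b [Cab a0 b0 ab]]].
have le1 : (load C <= 1)%N by rewrite l1.
have gT : gap a + gap b <= R - 1 by rewrite /gap; lia.
have uT x y : C x y -> gap x + gap y <= R - 1 -> x = a /\ y = b.
  by move=> Cxy g; apply: (load_le1_uniq le1 Cxy Cab).
have farT u v : C u v -> u <> a \/ v <> b -> R <= gap u + gap v.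
  move=> Cuv ne'; case: (Z_lt_le_dec (gap u + gap v) R) => // g.
  by case: (uT _ _ Cuv _) => [|eu ev]; [lia|case: ne'].
have [p [q [p' [q' [Cp Cp' ne [p1 q1 pq] [p1' q1' pq']]]]]] : exists p q p' q',
    [/\ C p q, C p' q', p <> p' \/ q <> q',
    [/\ 1 <= p, 1 <= q & p + q = R + 2] & [/\ 1 <= p', 1 <= q' & p' + q' = R + 2]].
  case: (cC 1 1) => [[p [q [Cpq d]]]|[p [q [p' [q' [Cp Cp' ne d d']]]]]].
    by exfalso; have := uT _ _ Cpq; rewrite /gap; lia.
  have gE u v : C u v -> Z.abs (1 - u) + Z.abs (1 - v) <= R ->
      [/\ 1 <= u, 1 <= v & u + v = R + 2].
    move=> Cuv duv; have g : R <= gap u + gap v.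
      by apply: farT Cuv _; lia.
    exact: gap_corner11.
  by exists p, q, p', q'; split=> //; apply: gE.
have other u v : Z.abs (u - a) + Z.abs (v - b) >= R ->
    exists x y, [/\ C x y, R <= gap x + gap y & Z.abs (u - x) + Z.abs (v - y) <= R].
  move=> du; case: (cC u v) => [[i [j [Cij d]]]|[i [j [i' [j' [Ci Ci' ne' d d']]]]]].
    exists i, j; split=> //; last by lia.
    by apply: farT Cij _; lia.
  case: (Z_lt_le_dec (gap i + gap j) R) => gi; last by exists i, j.
  case: (Z_lt_le_dec (gap i' + gap j') R) => gi'; last by exists i', j'.
  have [e1 e2] := uT _ _ Ci ltac:(lia).
  have [e3 e4] := uT _ _ Ci' ltac:(lia).
  by case: ne'; lia.
have [x [y [Cxy gxy dxy]]] := other 1 0 ltac:(lia).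
have [x' [y' [Cxy' gxy' dxy']]] := other 0 1 ltac:(lia).
have [x1 [y0 xy]] : 1 <= x /\ y <= 0 /\ x - 1 - y = R.
  by move: gxy; rewrite /gap; lia.
have [x1' [y0' xy']] : x' <= 0 /\ 1 <= y' /\ y' - 1 - x' = R.
  by move: gxy'; rewrite /gap; lia.
case: (pselect (side_claim C)) => [|nS]; first by constructor 1.
case: (pselect (side_claim (swap C))) => [|nS']; first by constructor 2.
case: (pselect (far_claim C)) => [|nF]; first by constructor 3; left.
case: (pselect (far_claim (swap C))) => [|nF']; first by constructor 3; right.
constructor 4.
(* If both are negative, the two towers reaching (1, 0) give a side claim. *)
have by0 : b = 0 \/ y = 0.
  case: (Z.eq_dec b 0) => [|bn]; first by left.
  case: (Z.eq_dec y 0) => [|yn]; first by right.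
  case: nS; split=> //; first by exists a, b; split=> //; split_lia.
  by exists x, y; split=> //; split_lia.
have ax0 : a = 0 \/ x' = 0.
  case: (Z.eq_dec a 0) => [|an]; first by left.
  case: (Z.eq_dec x' 0) => [|xn]; first by right.
  case: nS'; split; first by rewrite load_swap.
    by exists b, a; split=> //; split_lia.
  by exists y', x'; split=> //; split_lia.
(* Otherwise the towers beyond (1, 1) are the two tips, and one of them pairs with a tip at (1, 0)
   or (0, 1) into a far claim. *)
have nontip : (2 <= p /\ 2 <= q) \/ (2 <= p' /\ 2 <= q').
  apply: contrapT => nt.
  have [C1 C2] : C (1 + R) 1 /\ C 1 (1 + R).
    case: (Z.eq_dec p 1) => pe.
      have [e1 e2 e3] : [/\ q = 1 + R, p' = 1 + R & q' = 1] by split; lia.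
      by split; [rewrite -e2 -e3|rewrite -e1 -pe].
    have [e0 e1 e2 e3] : [/\ p = 1 + R, q = 1, p' = 1 & q' = 1 + R] by split; lia.
    by split; [rewrite -e0 -e1|rewrite -e3 -e2].
  (* If y is not 0, then b = 0 and a = 1 - R, which is negative as r > 1; so x' = 0 and the far
     claim points upwards. *)
  case: (Z.eq_dec y 0) => y00.
    apply: nF; split=> //.
    have -> : 1 + R = x by lia.
    by rewrite -y00.
  apply: nF'; split=> //; first by rewrite load_swap.
  have x00 : x' = 0 by lia.
  have e : 1 + R = y' by lia.
  by rewrite /swap e -x00.
split; first by rewrite load_view.
  case: nontip => nt; [exists (1 - p), (1 - q), (1 - p'), (1 - q')|
                       exists (1 - p'), (1 - q'), (1 - p), (1 - q)];
  by rewrite /view /mirror !Z.sub_sub_distr !Z.sub_diag !Z.add_0_l; split=> //; split_lia.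
right; rewrite !view_view /= view_id; split=> //.
exists (1 - a), (1 - b).
by rewrite /view /mirror !Z.sub_sub_distr !Z.sub_diag !Z.add_0_l; split=> //; split_lia.
Qed.

(** * Incompatible claims on one square *)

Lemma config_eq C x y x' y' : C x y -> x = x' -> y = y' -> C x' y'.
Proof. by move=> Cxy <- <-. Qed.

Lemma shiftE C i j x y : shift C i j (x - i) (y - j) = C x y.
Proof. by rewrite /shift !Z.sub_add. Qed.

Lemma load_shift_uniq C i j : (load (shift C i j) <= 1)%N ->
  forall x y x' y', C x y -> C x' y' ->
  gap (x - i) + gap (y - j) <= R - 1 -> gap (x' - i) + gap (y' - j) <= R - 1 ->
  x = x' /\ y = y'.
Proof.
move=> l1 x y x' y'; rewrite -(shiftE C i j x y) -(shiftE C i j x' y') => Cxy Cxy' g g'.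
by have := load_le1_uniq l1 Cxy Cxy' g g'; lia.
Qed.

Lemma load_shift_gap C i j : (load (shift C i j) <= 1)%N ->
  forall x y, C x y -> R - 1 <= gap (x - i) + gap (y - j).
Proof.
by move=> l1 x y; rewrite -(shiftE C i j x y) => Cxy; apply: load_le1_gap l1 _ _ Cxy.
Qed.

Lemma side_claim_shift C : side_claim (shift C 0 1) ->
  [/\ (load (shift C 0 1) <= 1)%N,
      exists x y, [/\ C x y, x <= 0, y <= 0 & x + y = 2 - R] &
      exists x y, [/\ C x y, 1 <= x, y <= 0 & x - y = R]].
Proof.
case=> l1 [x [y [Cxy x0 y0 xy]]] [x' [y' [Cxy' x0' y0' xy']]]; split=> //.
  by exists x, (y + 1); split; try lia; rewrite -[x in C x]Z.add_0_r.
by exists x', (y' + 1); split; try lia; rewrite -[x' in C x']Z.add_0_r.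
Qed.

(** The second tower of the claim from the right neighbour also contributes to the upper neighbour,
    in addition to the tower of the upper claim, so the upper load would be at least 2. *)
Lemma side_claims_disjoint C :
  side_claim (shift C 0 1) -> ~ side_claim (shift (swap C) 0 1).
Proof.
case/side_claim_shift=> l1 [x [y [Cxy x0 y0 xy]]] _.
case/side_claim_shift=> _ _ [x' [y' [Cxy' x0' y0' xy']]].
have := load_shift_gap l1 Cxy'.
have := load_shift_uniq l1 Cxy Cxy'.
by clear -x0 y0 xy x0' y0' xy' r_gt1; rewrite /gap; lia.
Qed.

Lemma diag_claim_shift C : diag_claim (shift C 1 1) ->
  exists x y x' y', [/\ C x y, C x' y', x <> x' \/ y <> y',
    [/\ x <= 0, y <= 0 & x + y = 2 - R] & [/\ x' <= 1, y' <= 1 & x' + y' = 2 - R]].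
Proof.
case=> _ [x [y [x' [y' [Cxy Cxy' ne [x0 y0 xy] [x0' y0' xy']]]]]] _.
by exists (x + 1), (y + 1), (x' + 1), (y' + 1); split; [exact: Cxy|exact: Cxy'| | |]; split_lia.
Qed.

Lemma diag_claim_swap C : diag_claim C -> diag_claim (swap C).
Proof.
case=> l1 [x [y [x' [y' [Cxy Cxy' ne [x0 y0 xy] [x0' y0' xy']]]]]] dis.
split; first by rewrite load_swap.
  by exists y, x, y', x'; split; [exact: Cxy|exact: Cxy'| | |]; split_lia.
rewrite load_swap; case: dis => [|[[p [q [Cpq p0 q0 pq]]] h1 h2 h3 h4]]; [by left|right].
split=> //; exists q, p; split=> //; lia.
Qed.

(** Starting from (1, 2), a common corner of the two claiming squares, coverage forces one tower
    after another until a side or far claim appears that [diag_claim] rules out. *)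
Lemma diag_side_disjoint C : covering R C ->
  diag_claim (shift C 1 1) -> ~ side_claim (shift C 0 1).
Proof.
move=> cC [lD _ dis] /side_claim_shift[lB [a [b [Cab a0 b0 ab]]] [e [f [Cef e1 f0 ef]]]].
(* The point (1, 2) is at distance R + 1 from (a, b), the only tower contributing to [0, 1] x
   [1, 2]. *)
have near u v : C u v -> Z.abs (1 - u) + Z.abs (2 - v) <= R ->
    [/\ 1 <= u, 2 <= v & u + v = R + 3].
  move=> Cuv duv; have := load_shift_uniq lB Cab Cuv.
  by move: duv; clear -a0 b0 ab; rewrite /gap => *; split_lia.
have [p [q [p' [q' [Cp Cp' ne [p1 q2 pq] [p1' q2' pq']]]]]] : exists p q p' q',
    [/\ C p q, C p' q', p <> p' \/ q <> q',
    [/\ 1 <= p, 2 <= q & p + q = R + 3] & [/\ 1 <= p', 2 <= q' & p' + q' = R + 3]].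
  case: (cC 1 2) => [[p [q [Cpq d]]]|[p [q [p' [q' [Cp Cp' ne d d']]]]]].
    have := near _ _ Cpq.
    by clear -d; case=> *; lia.
  by exists p, q, p', q'; split=> //; apply: near.
(* At most one of the two towers has first coordinate 1; the other contributes to [1, 2]^2, which
   excludes load 0. *)
case: dis => [l0|[[c [d [Ccd c1 d1 cd]]] nS nS' _ nF]].
  have g u v : C u v -> R <= gap (u - 1) + gap (v - 1).
    by rewrite -(shiftE C 1 1) => Cuv; apply: load0_gap l0 _ _ Cuv.
  move: (g _ _ Cp) (g _ _ Cp'); clear - p1 q2 pq p1' q2' pq' ne.
  by rewrite /gap; lia.
have {}Ccd : C (c + 1) (d + 1) by exact: Ccd.
have farT u v : C u v -> u <> c + 1 \/ v <> d + 1 -> R <= gap (u - 1) + gap (v - 1).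
  move=> Cuv ne'; case: (Z_lt_le_dec (gap (u - 1) + gap (v - 1)) R) => // g.
  have := load_shift_uniq lD Ccd Cuv.
  by move: g ne'; clear -c1 d1 cd; rewrite /gap; lia.
(* The towers reaching (1, 2), (2, 1) and (1, 1) outside the square [1, 2]^2 are forced
   to be tips, and the last two of them then allow a far claim. *)
have C1 : C 1 (R + 2).
  have tip u v : C u v -> u <> c + 1 \/ v <> d + 1 -> 1 <= u -> 2 <= v ->
      u + v = R + 3 -> C 1 (R + 2).
    move=> Cuv ne' u1 v2 uv; have := farT _ _ Cuv ne'.
    rewrite /gap => g; have [eu ev] : u = 1 /\ v = R + 2.
      by clear -g u1 v2 uv; split_lia.
    by rewrite -ev -{1}eu.
  case: (Z.eq_dec p (c + 1)) => [ep|np]; last by apply: tip Cp _ _ _ _ => //; left.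
  by apply: tip Cp' _ _ _ _ => //; clear -ep ne pq pq'; lia.
(* Otherwise (c + 1, d + 1) and (1, R + 2) give [1, 2]^2 a side claim on the square above it. *)
have d_eq : d = 1.
  apply: contrapT => dn; apply: nS; split; first by rewrite load_view.
    exists (1 - c), (1 - d); split; try (clear -c1 d1 cd dn; lia).
    by rewrite /view /mirror /shift; apply: (config_eq Ccd); lia.
  exists 1, (- R); split; try lia.
  by rewrite /view /mirror /shift; apply: (config_eq C1); lia.
have [i [j [Cij dij gij]]] : exists i j, [/\ C i j,
    Z.abs (2 - i) + Z.abs (1 - j) <= R & R <= gap (i - 1) + gap (j - 1)].
  case: (cC 2 1) => [[i [j [Cij dij]]]|[i [j [i' [j' [Ci Ci' nij di di']]]]]].
    exists i, j; split=> //; first lia.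
    by apply: farT Cij _; clear -dij c1 d1 cd; lia.
  case: (Z.eq_dec i (c + 1)) => ei; last by exists i, j; split=> //; apply: farT => //; left.
  case: (Z.eq_dec j (d + 1)) => ej; last by exists i, j; split=> //; apply: farT => //; right.
  by exists i', j'; split=> //; apply: farT => //; clear -ei ej nij; lia.
have [i2 [j1 ij]] : 2 <= i /\ j <= 1 /\ i - j = R + 1.
  by move: dij gij; clear; rewrite /gap; lia.
have i_eq : i = 2.
  apply: contrapT => ni; apply: nS'; split; first by rewrite load_swap load_view.
    exists (1 - d), (1 - c); split; try (clear -r_gt1 c1 d1 cd d_eq; lia).
    by rewrite /swap /view /mirror /shift; apply: (config_eq Ccd); lia.
  exists (2 - j), (2 - i); split; try (clear -i2 j1 ij ni; lia).
  by rewrite /swap /view /mirror /shift; apply: (config_eq Cij); lia.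
(* With e > 1 this tower would be a second one contributing to [1, 2]^2. *)
have e_eq : e = 1.
  apply: contrapT => ne1; have := farT _ _ Cef.
  by clear -ne1 e1 f0 ef d1; rewrite /gap; lia.
apply: nF; split; first by rewrite load_swap load_view.
  by rewrite /swap /view /mirror /shift; apply: (config_eq Cij); lia.
by rewrite /swap /view /mirror /shift; apply: (config_eq Cef); lia.
Qed.

Lemma far_claim_shift C : far_claim (shift C (-2) 0) -> C (R - 1) 0 /\ C (R - 1) 1.
Proof.
case=> _; rewrite /shift !Z.add_0_r => C0 C1.
have e : R - 1 = 1 + R + -2 by lia.
by rewrite e.
Qed.

(** In the view the two towers are (2 - R, 0) and (2 - R, 1). The latter alone puts load 2 on the
    upper neighbour, and both together put load 2 on the right one, so neither neighbour can
    claim. *)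
Lemma far_claim_no_side C : far_claim (shift C (-2) 0) -> forall s,
  ~ side_claim (shift (view C true s) 0 1) /\
  ~ side_claim (shift (swap (view C true s)) 0 1).
Proof.
move=> /far_claim_shift[C0 C1] s.
have [V0 V1] : view C true s (2 - R) 0 /\ view C true s (2 - R) 1.
  rewrite /view /mirror; case: s; split;
    by [apply: (config_eq C0); lia|apply: (config_eq C1); lia].
split=> -[l1 _ _].
  have := load_shift_gap l1 V1.
  by clear -r_gt1; rewrite /gap; lia.
have := @load_shift_uniq _ 0 1 l1 0 (2 - R) 1 (2 - R) V0 V1.
by clear -r_gt1; rewrite /gap; lia.
Qed.

(** A diagonal claim of [1, 2]^2 requires load 0 or a single contributing tower with both
    coordinates at least 2. *)
Lemma tower_no_diag C x y : C x y -> gap (x - 1) + gap (y - 1) <= R - 1 ->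
  x <= 1 \/ y <= 1 -> ~ diag_claim (shift C 1 1).
Proof.
move=> Cxy g xy [l1 _]; case=> [l0|[[c [d [Ccd c1 d1 cd]]] _ _ _ _]].
  have := load0_gap l0 (x := x - 1) (y := y - 1).
  by rewrite shiftE => /(_ Cxy); lia.
have {}Ccd : C (c + 1) (d + 1) by exact: Ccd.
have := load_shift_uniq l1 Cxy Ccd.
by move: g xy; clear -c1 d1 cd; rewrite /gap; lia.
Qed.

Lemma far_claim_no_diag C : far_claim (shift C (-2) 0) -> forall s1 s2,
  ~ diag_claim (shift (view C s1 s2) 1 1).
Proof.
move=> /far_claim_shift[C0 C1] s1 s2.
apply: (@tower_no_diag _ (mirror s1 (R - 1)) 1); last by right.
  by rewrite /view mirrorK; case: s2.
by clear -r_gt1; case: s1; rewrite /mirror /gap; lia.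
Qed.

(** * Load guaranteed by the claims received *)

(** [deep C]: a tower contributes 2 to the square [0, 1]^2 and does not contain the
    corner (1, 1) in the interior of its ball.  Every claim received through (1, 1)
    comes with such a tower. *)
Definition deep C : Prop := exists x y, [/\ C x y, x <= 0, y <= 0 & x + y = 2 - R].
Definition shallow C : Prop := exists x y, [/\ C x y, x <= 0, y <= 0 & x + y = 1 - R].

Lemma quad_deep C : (2 * `[< deep C >] <= quad C)%N.
Proof.
case: asboolP => // -[x [y [Cxy x0 y0 xy]]].
have := @quad_tower C x y Cxy x0 y0.
by clear -xy; lia.
Qed.

Lemma quad_shallow C : shallow C -> (2 * `[< deep C >] < quad C)%N.
Proof.
move=> [x [y [Cxy x0 y0 xy]]].
case: asboolP => [[x' [y' [Cxy' x0' y0' xy']]]|_].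
  have := @quad_tower2 C x y x' y' Cxy Cxy'.
  by clear -x0 y0 xy x0' y0' xy'; lia.
have := @quad_tower C x y Cxy x0 y0.
by clear -xy; lia.
Qed.

Lemma quad_deep2 C x y x' y' : C x y -> C x' y' -> x <> x' \/ y <> y' ->
  [/\ x <= 0, y <= 0 & x + y = 2 - R] -> [/\ x' <= 0, y' <= 0 & x' + y' = 2 - R] ->
  (2 * `[< deep C >] < quad C)%N.
Proof.
move=> Cxy Cxy' ne [x0 y0 xy] [x0' y0' xy'].
have := @quad_tower2 C x y x' y' Cxy Cxy' ne.
by have := leq_b1 `[< deep C >]; clear -x0 y0 xy x0' y0' xy'; lia.
Qed.

Definition deep_count C : nat :=
  (\sum_(s1 : bool) \sum_(s2 : bool) `[< deep (view C s1 s2) >])%N.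

Lemma deep_countE C : deep_count C =
  (`[< deep (view C true true) >] + `[< deep (view C true false) >]
   + `[< deep (view C false true) >] + `[< deep C >])%N.
Proof. by rewrite /deep_count !big_bool /= addnA. Qed.

Lemma load_deep C : (2 * deep_count C <= load C)%N.
Proof.
rewrite loadE deep_countE !mulnDr.
by rewrite !leq_add ?quad_deep.
Qed.

Lemma load_deep_lt C s1 s2 :
  (2 * `[< deep (view C s1 s2) >] < quad (view C s1 s2))%N ->
  (2 * deep_count C < load C)%N.
Proof.
rewrite loadE deep_countE.
have := quad_deep (view C true true); have := quad_deep (view C true false).
have := quad_deep (view C false true); have := quad_deep C.
by case: s1 s2 => [] []; rewrite ?view_id; clear; lia.
Qed.

Lemma deep_count_view C s1 s2 : deep_count (view C s1 s2) = deep_count C.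
Proof.
rewrite !deep_countE !view_view !addbF !addbT.
by case: s1 s2 => [] [] /=; rewrite ?view_id; lia.
Qed.

Lemma deep_swap C : deep (swap C) <-> deep C.
Proof. by split=> -[x [y [Cxy x0 y0 xy]]]; exists y, x; split=> //; lia. Qed.

Lemma deep_count_swap C : deep_count (swap C) = deep_count C.
Proof.
have ds s1 s2 : `[< deep (view (swap C) s1 s2) >] = `[< deep (view C s2 s1) >].
  by apply/asboolP/asboolP => /deep_swap.
by rewrite !deep_countE !ds (asbool_equiv_eq (deep_swap C)); lia.
Qed.

(** The second tower is shallow in a mirrored quadrant and supplies load beyond that of the deep
    towers. *)
Lemma side_claim_load C : side_claim (shift C 0 1) ->
  deep C /\ (2 * deep_count C < load C)%N.
Proof.
move=> /side_claim_shift[_ dC [x [y [Cxy x1 y0 xy]]]]; split=> //.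
apply: (@load_deep_lt _ true false); apply: quad_shallow.
by exists (1 - x), y; split; [apply: (config_eq Cxy)|..]; rewrite /mirror; lia.
Qed.

Lemma diag_claim_load C : diag_claim (shift C 1 1) ->
  deep C /\ (2 * deep_count C < load C)%N.
Proof.
case/diag_claim_shift=> x [y [x' [y' [Cxy Cxy' ne xyle [x1' y1' xy']]]]].
split; first by case: xyle => *; exists x, y.
(* If the second tower is a tip, it is shallow in a neighbouring quadrant; otherwise it is a second
   deep tower of the same quadrant. *)
case: (Z.eq_dec x' 1) => x'E.
  apply: (@load_deep_lt _ true false); apply: quad_shallow.
  by exists (1 - x'), y'; split; [apply: (config_eq Cxy')|..]; rewrite /mirror;
    clear -r_gt1 x'E xy'; lia.
case: (Z.eq_dec y' 1) => y'E.
  apply: (@load_deep_lt _ false true); apply: quad_shallow.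
  by exists x', (1 - y'); split; [apply: (config_eq Cxy')|..]; rewrite /mirror;
    clear -r_gt1 y'E xy'; lia.
apply: (@load_deep_lt _ false false); rewrite view_id.
apply: quad_deep2 Cxy Cxy' ne xyle _; split; lia.
Qed.

Lemma far_claim_deep C : far_claim (shift C (-2) 0) ->
  forall s, deep (view C true s).
Proof.
move=> /far_claim_shift[C0 C1] s; exists (2 - R), 0; split; try (clear -r_gt1; lia).
by rewrite /view /mirror; case: s; [apply: (config_eq C1)|apply: (config_eq C0)]; lia.
Qed.

(** The side and diagonal claims that [0, 1]^2 receives through its corner (1, 1). *)
Definition corner_in C : nat :=
  (`[< side_claim (shift C 0 1) >] + `[< side_claim (shift (swap C) 0 1) >]
   + `[< diag_claim (shift C 1 1) >])%N.

Lemma corner_in_load C : covering R C -> corner_in C = 0%N \/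
  [/\ corner_in C = 1%N, deep C & (2 * deep_count C < load C)%N].
Proof.
move=> cC; rewrite /corner_in.
case: asboolP => [S|_].
  have [dC lC] := side_claim_load S.
  case: asboolP => [/(side_claims_disjoint S)//|_].
  case: asboolP => [D|_]; first by case: (diag_side_disjoint cC D).
  by right.
case: asboolP => [S|_].
  have [/deep_swap dC lC] := side_claim_load S.
  case: asboolP => [/diag_claim_swap D|_].
    by case: (diag_side_disjoint (covering_swap cC) D).
  by rewrite deep_count_swap load_swap in lC; right.
case: asboolP => [/diag_claim_load[dC lC]|_]; first by right.
by left.
Qed.

(** Each direction of a far claim occurs once, because the remaining reflection only exchanges the
    two towers of the claim. *)
Definition claims_in C : nat :=
  (\sum_(s1 : bool) \sum_(s2 : bool) corner_in (view C s1 s2)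
   + \sum_(s : bool) `[< far_claim (shift (view C s false) (-2) 0) >]
   + \sum_(s : bool) `[< far_claim (shift (swap (view C false s)) (-2) 0) >])%N.

Lemma far_in_corner C : far_claim (shift C (-2) 0) ->
  [/\ corner_in (view C true true) = 0%N, corner_in (view C true false) = 0%N,
      deep (view C true true) & deep (view C true false)].
Proof.
move=> F; have dF := far_claim_deep F.
have c0 s : corner_in (view C true s) = 0%N.
  have [nS nS'] := far_claim_no_side F s.
  by rewrite /corner_in !asboolF //; exact: far_claim_no_diag.
by split.
Qed.

Lemma corner_in_swap C : corner_in (swap C) = corner_in C.
Proof.
rewrite /corner_in swapK (addnC (nat_of_bool `[< side_claim (shift C 0 1) >])).
congr (_ + nat_of_bool _)%N.
by apply/asboolP/asboolP => /diag_claim_swap D; exact: D.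
Qed.

Lemma far_in_corner_swap C : far_claim (shift (swap C) (-2) 0) ->
  [/\ corner_in (view C true true) = 0%N, corner_in (view C false true) = 0%N,
      deep (view C true true) & deep (view C false true)].
Proof.
case/far_in_corner => c1 c2 /deep_swap d1 /deep_swap d2.
split; [rewrite -corner_in_swap; exact: c1|rewrite -corner_in_swap; exact: c2| |].
  exact: d1.
exact: d2.
Qed.

(** With k > 0 corner claims and no far claim, at least k quadrants are deep and the load is at
    least 2k + 1. A far claim makes two quadrants deep that receive no corner claim, and then twice
    [deep_count] already suffices. *)
Lemma claims_in_load C : covering R C ->
  claims_in C = 0%N \/ (2 + claims_in C <= load C)%N.
Proof.
move=> cC; have cV s1 s2 : corner_in (view C s1 s2) = 0%N \/
    corner_in (view C s1 s2) = 1%N /\ `[< deep (view C s1 s2) >] /\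
    (2 * deep_count C < load C)%N.
  case: (corner_in_load (covering_view s1 s2 cC)) => [|[-> /asboolT -> lt]]; first by left.
  by right; rewrite -(deep_count_view C s1 s2) -(load_view C s1 s2).
have nL := @far_in_corner C.
have nR : far_claim (shift (view C true false) (-2) 0) ->
    [/\ corner_in (view C false true) = 0%N, corner_in C = 0%N,
        deep (view C false true) & deep C].
  by case/far_in_corner; rewrite !view_view /= view_id.
have nB := @far_in_corner_swap C.
have nT : far_claim (shift (swap (view C false true)) (-2) 0) ->
    [/\ corner_in (view C true false) = 0%N, corner_in C = 0%N,
        deep (view C true false) & deep C].
  by case/far_in_corner_swap; rewrite !view_view /= view_id.
have := load_deep C; have := cV true true; have := cV true false.
have := cV false true; have := cV false false.
rewrite /claims_in !big_bool /= !view_id deep_countE.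
case: (asboolP (far_claim (shift (view C true false) _ _)))
  => [/nR[cR1 cR2 /asboolT dR1 /asboolT dR2]|_];
case: (asboolP (far_claim (shift C _ _)))
  => [/nL[cL1 cL2 /asboolT dL1 /asboolT dL2]|_];
case: (asboolP (far_claim (shift (swap (view C false true)) _ _)))
  => [/nT[cT1 cT2 /asboolT dT1 /asboolT dT2]|_];
case: (asboolP (far_claim (shift (swap C) _ _)))
  => [/nB[cB1 cB2 /asboolT dB1 /asboolT dB2]|_];
clear nL nR nB nT;
rewrite ?cR1 ?cR2 ?dR1 ?dR2 ?cL1 ?cL2 ?dL1 ?dL2 ?cT1 ?cT2 ?dT1 ?dT2 ?cB1 ?cB2 ?dB1 ?dB2;
lia.
Qed.

(** * Claims sent against missing load *)

Definition claims_out C : nat :=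
  (\sum_(s1 : bool) \sum_(s2 : bool)
     (`[< side_claim (view C s1 s2) >] + `[< side_claim (swap (view C s1 s2)) >]
      + `[< diag_claim (view C s1 s2) >])
   + \sum_(s : bool) `[< far_claim (view C s false) >]
   + \sum_(s : bool) `[< far_claim (swap (view C false s)) >])%N.

Lemma far_claim_view C s1 s2 :
  far_claim (view C s1 s2) -> far_claim (view C s1 false).
Proof.
case: s2 => // -[l1 C0 C1]; split; [by move: l1; rewrite !load_view| |].
  exact: C1.
exact: C0.
Qed.

Lemma far_claim_swap_view C s1 s2 :
  far_claim (swap (view C s1 s2)) -> far_claim (swap (view C false s2)).
Proof. exact: (@far_claim_view (swap C) s2 s1). Qed.

Lemma claims_out_gt0 C s1 s2 :
  [\/ side_claim (view C s1 s2), side_claim (swap (view C s1 s2)),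
      far_claim (view C s1 s2) \/ far_claim (swap (view C s1 s2))
    | diag_claim (view (view C s1 s2) true true)] -> (0 < claims_out C)%N.
Proof.
rewrite /claims_out !big_bool /= view_view.
case=> [/asboolT|/asboolT|[/far_claim_view|/far_claim_swap_view] /asboolT|/asboolT];
  case: s1 s2 => [] [] /= ->; rewrite !addn_gt0 !lt0b ?orbT //=.
Qed.

(** Each of the four sides has a diagonal claim at one of its ends or a far claim across it. A
    diagonal claim serves two sides, so at least two claims are made. *)
Lemma claims_out_load0 C : covering R C -> load C = 0%N -> (2 <= claims_out C)%N.
Proof.
move=> cC l0.
have D s1 s2 : diag_claim (view C s1 s2) \/
    (view C s1 s2 (- R) 0 /\ view C s1 s2 0 (- R)).
  apply: diag_claim_load0; first exact: covering_view.
  by rewrite load_view.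
have l1 s1 s2 : (load (view C s1 s2) <= 1)%N by rewrite load_view l0.
have FX s : diag_claim (view C (~~ s) false) \/ diag_claim (view C (~~ s) true) \/
    far_claim (view C s false).
  case: (D (~~ s) false) => [|[t0 _]]; first by left.
  case: (D (~~ s) true) => [|[t1 _]]; first by right; left.
  rewrite /view in t0 t1; right; right; split=> //; rewrite /view.
    by apply: (config_eq t0) => //; case: (s); rewrite /mirror /=; lia.
  by apply: (config_eq t1) => //; case: (s); rewrite /mirror /=; lia.
have FY s : diag_claim (view C false (~~ s)) \/ diag_claim (view C true (~~ s)) \/
    far_claim (swap (view C false s)).
  case: (D false (~~ s)) => [|[_ t0]]; first by left.
  case: (D true (~~ s)) => [|[_ t1]]; first by right; left.
  rewrite /view in t0 t1; right; right.
  split; [by rewrite load_swap|rewrite /swap /view|rewrite /swap /view].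
    by apply: (config_eq t0) => //; case: (s); rewrite /mirror /=; lia.
  by apply: (config_eq t1) => //; case: (s); rewrite /mirror /=; lia.
have B P Q S : P \/ Q \/ S -> [|| `[< P >], `[< Q >] | `[< S >]].
  by rewrite -!asbool_or => /asboolT.
have := B _ _ _ (FX true); have := B _ _ _ (FX false).
have := B _ _ _ (FY true); have := B _ _ _ (FY false).
rewrite /claims_out !big_bool /= !view_id.
(* Side claims enter only as nonnegative terms; the diagonal and far claims are checked case by
   case. *)
do 8!move: (nat_of_bool (asbool (side_claim _))) => ?.
do 4!move: (asbool (diag_claim _)); do 4!move: (asbool (far_claim _)); clear.
by do 8!case=> //=; rewrite ?(addn0, add0n, addn1, addnS).
Qed.

Lemma claims_out_load C : covering R C -> (load C <= 1)%N ->
  (2 <= load C + claims_out C)%N.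
Proof.
move=> cC; case l: (load C) => [|[|//]] _; first exact: claims_out_load0.
have [x [y [Cxy gxy]]] : exists x y, C x y /\ gap x + gap y <= R - 1.
  by apply: load_gt0; rewrite l.
have [s1 [s2 [x' [y' [ex ey x0 y0 g]]]]] := quadrantP x y.
have g1 : R - 1 <= gap x + gap y.
  by apply: (@load_le1_gap C) => //; rewrite l.
suff : (0 < claims_out C)%N by lia.
apply: (@claims_out_gt0 C s1 s2); apply: claim_load1.
- exact: covering_view.
- by rewrite load_view.
by exists x', y'; split=> //; [rewrite /view -ex -ey|lia].
Qed.

Lemma discharge C : covering R C -> (2 + claims_in C <= load C + claims_out C)%N.
Proof.
move=> cC; have [->|] := claims_in_load cC; last by lia.
case: (leqP (load C) 1) => [/(claims_out_load cC)|]; lia.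
Qed.

End Discharging.

(** * Averaging over a period *)

(** The value is the odd number 2k - 1, or 0 for k = 0; [sum_depth] adds the odd numbers up to a
    square. *)
Lemma sum_minn2_sub r k : k <= r -> \sum_(b < r) minn 2 (k - b) = k + k.-1.
Proof.
elim: r k => [|r IHr] k kr; first by rewrite big_ord0; lia.
rewrite big_ord_recl /=.
rewrite (eq_bigr (fun b : 'I_r => minn 2 (k.-1 - b))) => [|b _].
  by rewrite IHr; lia.
by congr minn; rewrite /bump leq0n; lia.
Qed.

Lemma sum_depth r : \sum_(a < r) \sum_(b < r) minn 2 (r - (a + b)) = r ^ 2.
Proof.
have -> : \sum_(a < r) \sum_(b < r) minn 2 (r - (a + b)) =
    \sum_(a < r) ((r - a) + (r - a).-1).
  apply: eq_bigr => a _; rewrite -(@sum_minn2_sub r) ?leq_subr //.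
  by apply: eq_bigr => b _; rewrite subnDA.
elim: r => [|r IHr]; first by rewrite big_ord0.
rewrite big_ord_recl /=.
under eq_bigr => a _ do rewrite /bump leq0n add1n subSS.
by rewrite IHr; lia.
Qed.

Section Periodic.
Local Open Scope Z_scope.

Lemma sum_shift (m : nat) (g : Z -> nat) (a : Z) :
    (forall x, g (x + Z.of_nat m) = g x) ->
  (\sum_(i < m) g (Z.add (Z.of_nat i) a) = \sum_(i < m) g (Z.of_nat i))%N.
Proof.
move=> per.
have step b : (\sum_(i < m) g (Z.add (Z.of_nat i) (Z.succ b)) = \sum_(i < m) g (Z.add (Z.of_nat i) b))%N.
  (* After adding [g b], both sides sum m + 1 consecutive values starting at b, up to replacing the
     last one by [g b]. *)
  apply/eqP; rewrite -(eqn_add2l (g b)).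
  have := big_ord_recr (op := addn) (idx := 0%N) m (fun i : 'I_m.+1 => g (Z.of_nat i + b)).
  rewrite big_ord_recl /= Z.add_0_l.
  have -> : Z.of_nat m + b = b + Z.of_nat m by lia.
  rewrite per => e; apply/eqP; rewrite [RHS]addnC; apply: etrans e; congr (_ + _)%N.
  by apply: eq_bigr => i _; congr g; lia.
have z0 : (\sum_(i < m) g (Z.add (Z.of_nat i) 0) = \sum_(i < m) g (Z.of_nat i))%N.
  by apply: eq_bigr => i _; rewrite Z.add_0_r.
elim/Z.peano_ind: a => [//|b <-|b <-]; first exact: step.
by rewrite -step Z.succ_pred.
Qed.

Variables (m n : nat).

Definition psum (f : Z -> Z -> nat) : nat :=
  (\sum_(i < m) \sum_(j < n) f (Z.of_nat i) (Z.of_nat j))%N.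

Definition periodic T (f : Z -> Z -> T) : Prop :=
  forall x y, f (x + Z.of_nat m) y = f x y /\ f x (y + Z.of_nat n) = f x y.

Lemma psum_shift f a b : periodic f ->
  psum (fun x y => f (x + a) (y + b)) = psum f.
Proof.
move=> per; rewrite /psum.
transitivity (\sum_(i < m) \sum_(j < n) f (Z.add (Z.of_nat i) a) (Z.of_nat j))%N.
  apply: eq_bigr => i _; apply: (@sum_shift n (f (Z.of_nat i + a))) => y.
  exact: (proj2 (per _ y)).
rewrite exchange_big [RHS]exchange_big; apply: eq_bigr => j _.
by apply: (@sum_shift m (f^~ (Z.of_nat j))) => x; exact: (proj1 (per x _)).
Qed.

Lemma psumD f g : psum (fun x y => f x y + g x y)%N = (psum f + psum g)%N.
Proof.
by rewrite /psum -big_split; apply: eq_bigr => i _; rewrite big_split.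
Qed.

Lemma psum_sum (I : finType) (F : I -> Z -> Z -> nat) :
  psum (fun x y => \sum_(k : I) F k x y)%N = (\sum_(k : I) psum (F k))%N.
Proof.
rewrite /psum [RHS]exchange_big; apply: eq_bigr => i _.
by rewrite [RHS]exchange_big.
Qed.

Lemma psumMr f c : psum (fun x y => f x y * c)%N = (psum f * c)%N.
Proof.
by rewrite /psum big_distrl; apply: eq_bigr => i _; rewrite big_distrl.
Qed.

Lemma eq_psum f g : (forall x y, f x y = g x y) -> psum f = psum g.
Proof. by move=> fg; apply: eq_bigr => i _; apply: eq_bigr => j _. Qed.

Lemma leq_psum f g : (forall x y, (f x y <= g x y)%N) -> (psum f <= psum g)%N.
Proof. by move=> fg; apply: leq_sum => i _; apply: leq_sum => j _. Qed.

Variables (r : nat) (C : config).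
Hypothesis C_periodic : periodic C.

Lemma shift_periodic : periodic (shift C).
Proof.
move=> i j; split; apply/funext => x; apply/funext => y; rewrite /shift.
  by rewrite Z.add_assoc; case: (C_periodic (x + i) (y + j)).
by rewrite Z.add_assoc; case: (C_periodic (x + i) (y + j)).
Qed.

(** Each tower has total weight [r ^ 2] in each of the four quadrants, altogether twice the area of
    its ball. *)
Lemma psum_load :
  psum (fun i j => load r (shift C i j)) = (4 * r ^ 2 * psum (fun x y => C x y))%N.
Proof.
have Q s1 s2 : psum (fun i j => quad r (view (shift C i j) s1 s2)) =
    (psum (fun x y => C x y) * r ^ 2)%N.
  rewrite psum_sum -(sum_depth r) big_distrr; apply: eq_bigr => a _.
  rewrite psum_sum big_distrr; apply: eq_bigr => b _.
  rewrite psumMr; congr (_ * _)%N.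
  rewrite -[RHS](@psum_shift _ (mirror s1 (- Z.of_nat a)) (mirror s2 (- Z.of_nat b))).
    by apply: eq_psum => x y; rewrite /view /shift !(Z.add_comm (mirror _ _)).
  by move=> x y; case: (C_periodic x y) => -> ->.
rewrite psum_sum big_bool !psum_sum !big_bool !Q.
by move: (psum _) (r ^ 2)%N => K w /=; lia.
Qed.

(** A claim received from the square at offset (a, b) is one sent by that square. Summing over a
    period absorbs this translation, whose signs follow the reflections. *)
Lemma psum_claim (K : config -> Prop) s1 s2 a b :
  psum (fun i j => `[< K (shift (view (shift C i j) s1 s2) a b) >]) =
  psum (fun i j => `[< K (view (shift C i j) s1 s2) >]).
Proof.
pose sg (s : bool) c := if s then - c else c.
rewrite -(@psum_shift (fun i j => `[< K (view (shift C i j) s1 s2) >] : nat)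
  (sg s1 a) (sg s2 b)); last first.
  by move=> x y; case: (shift_periodic x y) => -> ->.
apply: eq_psum => i j; congr (nat_of_bool `[< K _ >]).
apply/funext => x; apply/funext => y; rewrite /shift /view /sg.
by congr C; [case: (s1)|case: (s2)]; rewrite /mirror; lia.
Qed.

Lemma psum_claims :
  psum (fun i j => claims_in r (shift C i j)) =
  psum (fun i j => claims_out r (shift C i j)).
Proof.
rewrite /claims_in /claims_out !psumD !psum_sum; congr (_ + _ + _)%N.
- apply: eq_bigr => s1 _; rewrite !psum_sum; apply: eq_bigr => s2 _.
  rewrite !psumD !psum_claim; congr (_ + _ + _)%N.
  (* Moving [swap] outside the shift turns the offset (0, 1) into (1, 0). *)
  exact: (psum_claim (fun D => side_claim r (swap D)) s1 s2 1 0).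
- by apply: eq_bigr => s _; rewrite psum_claim.
apply: eq_bigr => s _.
exact: (psum_claim (fun D => far_claim r (swap D)) false s 0 (-2)).
Qed.

Lemma covering_density : (1 < r)%N -> covering (Z.of_nat r) C ->
  (m * n <= 2 * r ^ 2 * psum (fun x y => C x y))%N.
Proof.
move=> r_gt1 cC.
have : (psum (fun i j => 2 + claims_in r (shift C i j))
    <= psum (fun i j => load r (shift C i j) + claims_out r (shift C i j)))%N.
  by apply: leq_psum => i j; apply: discharge => //; apply: covering_shift.
rewrite (psumD (fun _ _ => 2%N)) (psumD (fun i j => load r (shift C i j))).
rewrite psum_claims leq_add2r psum_load.
have -> : psum (fun _ _ => 2%N) = (2 * (m * n))%N.
  by rewrite /psum !sum_nat_const !card_ord; lia.
by rewrite -[4%N]/(2 * 2)%N -!mulnA leq_pmul2l.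
Qed.

End Periodic.

(** * Tiling the plane by the grid *)

Section Grid.
Variables (m n : nat).
Hypotheses (m_gt0 : 0 < m) (n_gt0 : 0 < n).
Notation adj := (@grid_adj m n).
Local Open Scope Z_scope.

Definition norm1 (u v : 'I_m * 'I_n) : Z :=
  Z.abs (Z.of_nat u.1 - Z.of_nat v.1) + Z.abs (Z.of_nat u.2 - Z.of_nat v.2).

Lemma norm1_path u p : path adj u p -> norm1 u (last u p) <= Z.of_nat (size p).
Proof.
elim: p u => [|v p IHp] u /=; first by rewrite /norm1; lia.
case/andP => uv /IHp; move: (last v p) => w.
have : norm1 u v <= 1.
  move: uv; rewrite /grid_adj /norm1 /consecutive -!val_eqE /=; lia.
by rewrite /norm1; lia.
Qed.

Lemma sig_norm1 t u v : (0 < sig adj t u v)%N ->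
  norm1 u v <= Z.of_nat t - Z.of_nat (sig adj t u v).
Proof.
rewrite /sig; case: ifP => // /dist_has_walk/has_walkP[p [/norm1_path le_p pv <-]].
by move: le_p; rewrite pv; move: (norm1 u v) (size p) => a b; lia.
Qed.

Lemma residue_subproof k (k_gt0 : (0 < k)%N) x :
  (Z.to_nat (x mod Z.of_nat k) < k)%N.
Proof. have := Z.mod_pos_bound x (Z.of_nat k); lia. Qed.

Definition residue k (k_gt0 : (0 < k)%N) x : 'I_k := Ordinal (residue_subproof k_gt0 x).

Lemma residueE k (k_gt0 : (0 < k)%N) (i : 'I_k) q :
  residue k_gt0 (Z.of_nat i + Z.of_nat k * q) = i.
Proof.
apply: val_inj; rewrite /= Z.mul_comm Z_mod_plus_full Z.mod_small ?Nat2Z.id //.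
by have := ltn_ord i; lia.
Qed.

Lemma residue_periodic k (k_gt0 : (0 < k)%N) x :
  residue k_gt0 (x + Z.of_nat k) = residue k_gt0 x.
Proof.
by apply: val_inj; rewrite /= -{1}[Z.of_nat k]Z.mul_1_l Z_mod_plus_full.
Qed.

Definition tiling (S : {set 'I_m * 'I_n}) : config :=
  fun x y => (residue m_gt0 x, residue n_gt0 y) \in S.

Lemma tiling_periodic S : periodic m n (tiling S).
Proof. by move=> x y; rewrite /tiling !residue_periodic. Qed.

Lemma psum_tiling S : psum m n (fun x y => tiling S x y) = #|S|.
Proof.
rewrite /psum pair_bigA -sum1_card [RHS]big_mkcond /=.
apply: eq_bigr => -[i j] _; rewrite /tiling /=.
rewrite -[Z.of_nat i]Z.add_0_r -[Z.of_nat j]Z.add_0_r.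
by rewrite -{1}(Z.mul_0_r (Z.of_nat m)) -(Z.mul_0_r (Z.of_nat n)) !residueE; case: ifP.
Qed.

Lemma tiling_covering t S : broadcast adj t 2 S ->
  covering (Z.of_nat t - 1) (tiling S).
Proof.
move=> /forallP bS x y; pose v := (residue m_gt0 x, residue n_gt0 y).
(* Towers are copied into the tile containing (x, y), so their distances to (x, y) equal those to
   [v] in the grid. *)
pose px (u : 'I_m * 'I_n) := Z.of_nat u.1 + Z.of_nat m * (x / Z.of_nat m).
pose py (u : 'I_m * 'I_n) := Z.of_nat u.2 + Z.of_nat n * (y / Z.of_nat n).
have tS u : u \in S -> tiling S (px u) (py u).
  by rewrite /tiling !residueE -surjective_pairing.
have dS u : Z.abs (x - px u) + Z.abs (y - py u) = norm1 u v.
  rewrite /norm1 /px /py /v /=.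
  have := Z.div_mod x (Z.of_nat m); have := Z.div_mod y (Z.of_nat n).
  have := Z.mod_pos_bound x (Z.of_nat m); have := Z.mod_pos_bound y (Z.of_nat n).
  by lia.
have pos (A : pred ('I_m * 'I_n)) : (0 < \sum_(u in S | A u) sig adj t u v)%N ->
    exists u, [/\ u \in S, A u & (0 < sig adj t u v)%N].
  rewrite lt0n sum_nat_eq0 negb_forall_in => /exists_inP[u /andP[uS Au] nz].
  by exists u; rewrite lt0n.
have [u [uS _ su]] : exists u, [/\ u \in S, predT u & (0 < sig adj t u v)%N].
  by apply: pos; rewrite big_mkcondr /=; apply: leq_trans (bS v).
(* Total signal 2 comes from one tower at distance at most t - 2, or from two at distance at most t
   - 1. *)
case: (leqP 2 (sig adj t u v)) => su2.
  left; exists (px u), (py u); split; first exact: tS.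
  by rewrite dS; have := sig_norm1 su; lia.
have [w [wS wu sw]] : exists w, [/\ w \in S, w != u & (0 < sig adj t w v)%N].
  by apply: pos; have := bS v; rewrite (bigD1 u) //=; lia.
right; exists (px u), (py u), (px w), (py w); split; try exact: tS.
- apply: contrapT => /not_orP[/contrapT ex /contrapT ey]; move/eqP: wu; apply.
  case: w u ex ey {wS sw uS su su2} => [w1 w2] [u1 u2]; rewrite /px /py /= => ex ey.
  by congr pair; apply: val_inj => /=; lia.
- by rewrite dS; have := sig_norm1 su; lia.
by rewrite dS; have := sig_norm1 sw; lia.
Qed.

End Grid.

(** * The lower bound for the grid graph *)

Import Order.TTheory GRing.Theory Num.Theory.
Local Open Scope ring_scope.

Theorem theorem2 (m n t : nat) (hm : (1 <= m)%N) (hn : (1 <= n)%N)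
    (ht : (2 < t)%N) :
  (m%:R * n%:R) / (2 * (t%:R - 1) ^+ 2)
    <= (broadcast_number (@grid_adj m n) t 2)%:R :> rat.
Proof.
(* Since t > 2, the set of all vertices is a broadcast, so the minimum is attained by some [S]. *)
have [|[S bS <-] _] := @broadcast_numberP _ (@grid_adj m n) t 2.
  by exists [set: _]; apply: broadcastT; apply: ltnW.
have -> : t%:R - 1 = (t.-1)%:R :> rat by rewrite -subn1 natrB // ltnW // ltnW.
have t1_gt0 : (0 < t.-1)%N by lia.
rewrite ler_pdivrMr ?mulr_gt0 ?exprn_gt0 ?ltr0n //.
have -> : 2 = 2%:R :> rat by [].
rewrite -natrX -!natrM ler_nat [leqRHS]mulnC -(psum_tiling hm hn S).
apply: covering_density; [exact: tiling_periodic|lia|].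
have -> : Z.of_nat t.-1 = Z.sub (Z.of_nat t) 1 by lia.
exact: tiling_covering.
Qed.
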